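(* Let $v,k_1,k_2,k_3,\lambda_1,\lambda_2,\lambda_3$ be positive integers with $k_1+k_2+k_3<v$. Then there does not exist a $(v,3;k_1,k_2,k_3;\lambda_1,\lambda_2,\lambda_3)$-GSEDF (in any abelian group of order $v$).
   Context: Let $G$ be a finite abelian group of order $v$, written additively with identity $0$, let $m\ge 2$, and let $\lambda_1,\dots,\lambda_m$ be positive integers. For disjoint subsets $A,B\subseteq G$, let $\Delta(A,B)$ be the multiset $\{x-y : x\in A, y\in B\}$. A $(v,m;k_1,\dots,k_m;\lambda_1,\dots,\lambda_m)$-generalized strong external difference family (GSEDF) in $G$ is a collection $\{D_1,\dots,D_m\}$ of mutually disjoint nonempty subsets of $G$ with $|D_i|=k_i$ such that for every $i$, $1\le i\le m$, the multiset union $\bigcup_{1\le j\le m,\, j\ne i}\Delta(D_i,D_j)$ contains every element of $G\setminus\{0\}$ exactly $\lambda_i$ times and does not contain $0$. *)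

(* Defs.v *)
From HB Require Import structures.
From mathcomp Require Import all_boot all_algebra.
Set Implicit Arguments.
Unset Strict Implicit.
Unset Printing Implicit Defensive.
Import GRing.Theory.

(* Finite multisets of elements of G are represented by sequences, with
   multiplicity [count_mem] and multiset sum [++]. *)
Definition Delta (G : finZmodType) (A B : {set G}) : seq G :=
  [seq (x - y)%R | x <- enum A, y <- enum B].

Definition ext_diffs (G : finZmodType) (m : nat) (D : m.-tuple {set G})
    (i : 'I_m) : seq G :=
  \big[cat/[::]]_(j < m | j != i) Delta (tnth D i) (tnth D j).

Definition is_GSEDF (G : finZmodType) (v m : nat) (k lambda : m.-tuple nat)
    (D : m.-tuple {set G}) : Prop :=
  [/\ #|G| = v, 1 < m & forall i : 'I_m, 0 < tnth lambda i] /\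
  [/\ forall i j : 'I_m, i != j -> [disjoint tnth D i & tnth D j],
      forall i : 'I_m, tnth D i != set0,
      forall i : 'I_m, #|tnth D i| = tnth k i,
      forall (i : 'I_m) (g : G), g != 0%R ->
        count_mem g (ext_diffs D i) = tnth lambda i
    & forall i : 'I_m, 0%R \notin ext_diffs D i].

(* Main.v *)
(** In the integral group ring of [G], realised by circulant matrices, write
    [X^T] for the involution induced by negation, [J] for the sum of all group
    elements and [K = J - 1].  The hypotheses read [A B^T + A C^T = a K] and
    cyclically, hence [A B^T + B A^T = (a + b - c) K], and comparing
    augmentations, [a + b - c > 0]; cyclically, three positive coefficients
    [m1], [m2], [m3] arise.

    Put [S = A + B + C].  Each [A S^T = A A^T + a K] is symmetric, whence
    [A B^T S = B A^T S].  If [F = |G| S - |S| J] is the multiple of the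
    projection of [S] to the augmentation ideal, then [J F = 0] and so
    [2 A B^T F = - m1 F].  Multiplying the three such relations gives
    [8 (A A^T) (B B^T) (C C^T) F = - m1 m2 m3 F].  The operator on the left is
    positive semidefinite, so [F = 0], i.e. the indicator function of the union
    of the three sets is constant, which is absurd. *)
Require Import Defs.
From HB Require Import structures.
From mathcomp Require Import all_boot all_order all_algebra.
From mathcomp Require Import ring zify.

Set Implicit Arguments.
Unset Strict Implicit.
Unset Printing Implicit Defensive.
Import Order.TTheory GRing.Theory Num.Theory.

(** * Circulant matrices as a model of the group ring of [G] *)

Section Circulant.
Local Open Scope ring_scope.
Variables (R : comPzRingType) (G : finZmodType).
Implicit Types f g : G -> R.

(** In this model convolution becomes the matrix product and negation of the argument the transpose,
    so traces of Gram matrices can be used for positivity. *)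
Definition circ f : 'M[R]_#|G| := \matrix_(i, j) f (enum_val i - enum_val j).

Lemma sum_enum_val f : \sum_(i < #|G|) f (enum_val i) = \sum_x f x.
Proof.
by rewrite [RHS](reindex (@enum_val G predT)) //; exact/onW_bij/enum_val_bij.
Qed.

Lemma eq_circ f g : f =1 g -> circ f = circ g.
Proof. by move=> fg; apply/matrixP=> i j; rewrite !mxE fg. Qed.

Lemma circT f : (circ f)^T = circ (fun x => f (- x)).
Proof. by apply/matrixP=> i j; rewrite !mxE opprB. Qed.

Lemma circM f g : circ f *m circ g = circ (fun x => \sum_y f y * g (x - y)).
Proof.
apply/matrixP=> i j; rewrite !mxE.
under eq_bigr => l _ do rewrite !mxE.
rewrite (sum_enum_val (fun z => f (enum_val i - z) * g (z - enum_val j))).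
rewrite (reindex_inj (inj_comp (addrI (enum_val i)) oppr_inj)) /=.
apply: eq_bigr => y _; congr (f _ * g _).
  by rewrite opprD opprK addrA subrr add0r.
by rewrite addrAC.
Qed.

(** Substituting [x - y] for [y] exchanges the two factors of the convolution. *)
Lemma circC f g : circ f *m circ g = circ g *m circ f.
Proof.
rewrite !circM; apply: eq_circ => x.
rewrite (reindex_inj (inj_comp (addrI x) oppr_inj)) /=.
by apply: eq_bigr => y _; rewrite mulrC opprD opprK addrA subrr add0r.
Qed.

Lemma circ_mul_const f :
  circ f *m const_mx 1 = (\sum_x f x) *: const_mx 1 :> 'M_#|G|.
Proof.
have -> : const_mx 1 = circ (fun=> 1) by apply/matrixP=> i j; rewrite !mxE.
rewrite circM; apply/matrixP=> i j; rewrite !mxE mulr1.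
by apply: eq_bigr => y _; rewrite mulr1.
Qed.

End Circulant.

(** * Positivity of the trace form *)

Section Trace.
Local Open Scope ring_scope.
Variable R : realDomainType.

Lemma mulmx_tr_diag_ge0 m n (A : 'M[R]_(m, n)) i : 0 <= (A^T *m A) i i.
Proof. by rewrite mxE; apply: sumr_ge0 => j _; rewrite mxE -expr2 sqr_ge0. Qed.

Lemma mxtrace_mulmx_tr_ge0 m n (A : 'M[R]_(m, n)) : 0 <= \tr (A^T *m A).
Proof. by apply: sumr_ge0 => i _; apply: mulmx_tr_diag_ge0. Qed.

(** The trace is the sum of the squares of all entries of [A]. *)
Lemma mxtrace_mulmx_tr_le0 m n (A : 'M[R]_(m, n)) :
  \tr (A^T *m A) <= 0 -> A = 0.
Proof.
move=> A_le0.
have A_eq0 : \tr (A^T *m A) = 0.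
  by apply/eqP; rewrite eq_le A_le0 mxtrace_mulmx_tr_ge0.
have diag_eq0 j : (A^T *m A) j j = 0.
  by apply: (psumr_eq0P _ A_eq0) => // i _; apply: mulmx_tr_diag_ge0.
apply/matrixP=> i j; rewrite [RHS]mxE; move: (diag_eq0 j); rewrite mxE.
move=> /psumr_eq0P sq_eq0; apply/eqP; rewrite -sqrf_eq0 expr2; apply/eqP.
have := sq_eq0 _ i isT; rewrite mxE; apply=> l _.
by rewrite mxE -expr2 sqr_ge0.
Qed.

End Trace.

(** * Indicator matrices of subsets and their differences *)

Section Sets.
Local Open Scope ring_scope.
Variable G : finZmodType.
Implicit Types A B C U V X : {set G}.

Definition set_mx A : 'M[int]_#|G| := circ (fun x => (x \in A)%:R).

Lemma set_mxC A B : set_mx A *m set_mx B = set_mx B *m set_mx A.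
Proof. exact: circC. Qed.

Lemma set_mxCT A B : set_mx A *m (set_mx B)^T = (set_mx B)^T *m set_mx A.
Proof. by rewrite /set_mx circT circC. Qed.

Lemma sum_indicator A : \sum_x (x \in A)%:R = #|A|%:R :> int.
Proof.
rewrite -sum1_card natr_sum [RHS]big_mkcond.
by apply: eq_bigr => x _; case: ifP.
Qed.

Lemma set_mx_const A :
  set_mx A *m const_mx 1 = #|A|%:R *: const_mx 1 :> 'M_#|G|.
Proof. by rewrite circ_mul_const sum_indicator. Qed.

Lemma set_mx_tr_const A :
  (set_mx A)^T *m const_mx 1 = #|A|%:R *: const_mx 1 :> 'M_#|G|.
Proof.
by rewrite circT circ_mul_const -sum_indicator [in RHS](reindex_inj oppr_inj) //.
Qed.

Lemma const_set_mx A :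
  const_mx 1 *m set_mx A = #|A|%:R *: const_mx 1 :> 'M_#|G|.
Proof.
by apply: trmx_inj; rewrite trmx_mul linearZ /= trmx_const set_mx_tr_const.
Qed.

Lemma count_Delta A B (g : G) :
  (count_mem g (Delta A B))%:R = \sum_x (x \in A)%:R * (x - g \in B)%:R :> int.
Proof.
rewrite /Delta count_flatten sumnE !big_map big_enum /= natr_sum big_mkcond.
apply: eq_bigr => x _; case: (x \in A); rewrite ?mul0r // mul1r count_map.
rewrite -mem_enum -count_uniq_mem ?enum_uniq //; congr (_%:R).
by apply: eq_count => y /=; apply/eqP/eqP=> [<-|->]; rewrite subKr.
Qed.

Lemma set_mx_mul_tr A B :
  set_mx A *m (set_mx B)^T = circ (fun g => (count_mem g (Delta A B))%:R).
Proof.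
rewrite /set_mx circT circM; apply: eq_circ => g; rewrite count_Delta.
by apply: eq_bigr => x _; rewrite opprB.
Qed.


(** * Augmentation relations and centred matrices *)

Local Notation J := (const_mx 1 : 'M[int]_#|G|).
Local Notation K := (J - 1%:M).

Lemma trmx_augmentation : K^T = K.
Proof. by rewrite linearB /= trmx_const trmx1. Qed.

(** The transpose of the third relation is [A C^T + B C^T = c L]; subtracting it from the sum of the
    first two cancels every term in [C]. *)
Lemma cross_sum n (A B C L : 'M[int]_n) (a b c : int) : L^T = L ->
    A *m B^T + A *m C^T = a *: L ->
    B *m C^T + B *m A^T = b *: L ->
    C *m A^T + C *m B^T = c *: L ->
  A *m B^T + B *m A^T = (a + b - c) *: L.
Proof.
move=> L_sym eqA eqB /(congr1 trmx).
rewrite linearD linearZ /= !trmx_mul !trmxK L_sym => eqC.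
rewrite scalerBl scalerDl -eqA -eqB -eqC.
apply/matrixP=> i j; rewrite !mxE; ring.
Qed.

(** The factor [#|G|] clears the denominator of the projection, so that all entries stay
    integral. *)
Definition centred_mx V : 'M_#|G| := #|G|%:R *: set_mx V - #|V|%:R *: J.

Lemma const_mul_const : J *m J = #|G|%:R *: J.
Proof.
apply/matrixP=> i j; rewrite !mxE.
under eq_bigr => l _ do rewrite !mxE mulr1.
by rewrite sumr_const card_ord mulr1.
Qed.

Lemma augmentation_mul_const : K *m J = (#|G|%:R - 1) *: J.
Proof. by rewrite mulmxBl mul1mx const_mul_const scalerBl scale1r. Qed.

Lemma const_mul_centred V : J *m centred_mx V = 0.
Proof.
rewrite mulmxBr -!scalemxAr const_set_mx const_mul_const !scalerA mulrC.
exact: subrr.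
Qed.

Lemma augmentation_mul_centred V : K *m centred_mx V = - centred_mx V.
Proof. by rewrite mulmxBl const_mul_centred mul1mx sub0r. Qed.

(** An entry at a difference lying in [V] reads [#|G| - #|V| = 0]. *)
Lemma centred_mx_eq0 V : centred_mx V = 0 -> (V == set0) || (V == setT).
Proof.
move=> F0; have entry x y : #|G|%:R * (x - y \in V)%:R - #|V|%:R = 0 :> int.
  have /matrixP/(_ (enum_rank x) (enum_rank y)) := F0.
  by rewrite !mxE !enum_rankK mulr1.
have G_gt0 : (0 < #|G|)%N by apply/card_gt0P; exists 0.
have [->|[x xV]] := set_0Vmem V; first by rewrite eqxx.
have := entry x 0; rewrite subr0 xV mulr1 => /eqP; rewrite subr_eq0 => /eqP.
move=> /eqP; rewrite eqr_nat => /eqP cardV.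
by rewrite [V == setT]eqEcard subsetT cardsT cardV leqnn orbT.
Qed.

Lemma set_mx_cross_const A B :
  set_mx A *m (set_mx B)^T *m J = (#|A| * #|B|)%:R *: J.
Proof.
rewrite -mulmxA set_mx_tr_const -scalemxAr set_mx_const scalerA natrM.
by rewrite mulrC.
Qed.

(** * The relation attached to one pair of the three sets *)

Section Pair.
Variables (A B C U : {set G}) (a b c : int).
Hypothesis eqU : set_mx U = set_mx A + set_mx B + set_mx C.
Hypothesis eqA :
  set_mx A *m (set_mx B)^T + set_mx A *m (set_mx C)^T = a *: K.
Hypothesis eqB :
  set_mx B *m (set_mx C)^T + set_mx B *m (set_mx A)^T = b *: K.
Hypothesis eqC :
  set_mx C *m (set_mx A)^T + set_mx C *m (set_mx B)^T = c *: K.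

Let symm : set_mx A *m (set_mx B)^T + set_mx B *m (set_mx A)^T =
  (a + b - c) *: K.
Proof. exact: cross_sum trmx_augmentation eqA eqB eqC. Qed.

(** Multiplying [symm] by [J] gives [2 |A| |B| = (a + b - c) (|G| - 1)], where the left side is
    positive and [|G| - 1] is nonnegative. *)
Lemma cross_coef_gt0 : A != set0 -> B != set0 -> 0 < a + b - c.
Proof.
rewrite -!card_gt0 => A_gt0 B_gt0.
have /(congr1 (fun M => M *m J)) := symm.
rewrite mulmxDl -scalemxAl augmentation_mul_const !set_mx_cross_const scalerA.
have i0 : 'I_#|G| := enum_rank 0.
move=> /matrixP/(_ i0 i0); rewrite !mxE !mulr1 => eq_m.
have G_gt0 : (0 < #|G|)%N by apply/card_gt0P; exists 0.
have : (0 < #|A| * #|B|)%N by rewrite muln_gt0 A_gt0.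
nia.
Qed.

Lemma set_mx_union_symm (X : {set G}) (l : int) :
    set_mx X *m (set_mx U)^T = set_mx X *m (set_mx X)^T + l *: K ->
  set_mx X *m (set_mx U)^T = set_mx U *m (set_mx X)^T.
Proof.
move=> eqX; rewrite -[RHS]trmxK trmx_mul trmxK eqX.
rewrite [RHS]linearD /= [(l *: _)^T]linearZ /= trmx_mul trmxK.
by rewrite trmx_augmentation.
Qed.

Lemma cross_mul_centred :
  2%:R *: (set_mx A *m (set_mx B)^T *m centred_mx U) =
  - (a + b - c) *: centred_mx U.
Proof.
have trU : (set_mx U)^T = (set_mx A)^T + (set_mx B)^T + (set_mx C)^T.
  by rewrite eqU !linearD.
have symA : set_mx A *m (set_mx U)^T = set_mx U *m (set_mx A)^T.
  by apply: (set_mx_union_symm (l := a)); rewrite trU !mulmxDr -eqA addrA.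
have symB : set_mx B *m (set_mx U)^T = set_mx U *m (set_mx B)^T.
  apply: (set_mx_union_symm (l := b)); rewrite trU !mulmxDr -eqB.
  by rewrite -addrA addrC addrA.
(* By [symA], [symB] and commutativity both sides equal [A B U^T]. *)
have swapU : set_mx A *m (set_mx B)^T *m set_mx U =
             set_mx B *m (set_mx A)^T *m set_mx U.
  rewrite -!mulmxA -!(set_mxCT U) -symA -symB !mulmxA.
  by rewrite (set_mxC A).
have swap : set_mx A *m (set_mx B)^T *m centred_mx U =
            set_mx B *m (set_mx A)^T *m centred_mx U.
  rewrite !mulmxBr -!scalemxAr swapU !set_mx_cross_const.
  by rewrite mulnC.
(* One of the two copies of [A B^T F] is turned into [B A^T F], so that [symm] applies; then
   [K F = - F]. *)
rewrite scaler_nat mulr2n {2}swap -mulmxDl symm -scalemxAl.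
by rewrite augmentation_mul_centred scalerN scaleNr.
Qed.

End Pair.

(** * Combining the three pairs by positivity *)

Lemma triple_union_trivial (A B C U : {set G}) (a b c : int) :
    set_mx U = set_mx A + set_mx B + set_mx C ->
    A != set0 -> B != set0 -> C != set0 ->
    set_mx A *m (set_mx B)^T + set_mx A *m (set_mx C)^T = a *: K ->
    set_mx B *m (set_mx C)^T + set_mx B *m (set_mx A)^T = b *: K ->
    set_mx C *m (set_mx A)^T + set_mx C *m (set_mx B)^T = c *: K ->
  (U == set0) || (U == setT).
Proof.
move=> eqU A_n0 B_n0 C_n0 eqA eqB eqC; apply: centred_mx_eq0.
have eqU' : set_mx U = set_mx B + set_mx C + set_mx A.
  by rewrite eqU -addrA addrC.
have eqU'' : set_mx U = set_mx C + set_mx A + set_mx B.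
  by rewrite eqU' -addrA addrC.
have mAB_gt0 := cross_coef_gt0 eqA eqB eqC A_n0 B_n0.
have mBC_gt0 := cross_coef_gt0 eqB eqC eqA B_n0 C_n0.
have mCA_gt0 := cross_coef_gt0 eqC eqA eqB C_n0 A_n0.
have mulAB := cross_mul_centred eqU eqA eqB eqC.
have mulBC := cross_mul_centred eqU' eqB eqC eqA.
have mulCA := cross_mul_centred eqU'' eqC eqA eqB.
set F := centred_mx U in mulAB mulBC mulCA *.
(* With this choice [E^T E] rearranges to [F^T (A B^T) (B C^T) (C A^T) F], which exhibits the
   positive semidefinite form as a Gram matrix. *)
set E := (set_mx C)^T *m (set_mx B *m (set_mx A)^T *m F).
have mulE : 8%:R *: (E^T *m E) =
    - ((a + b - c) * (b + c - a) * (c + a - b)) *: (F^T *m F).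
  pose P X Y : 'M_#|G| := set_mx X *m (set_mx Y)^T.
  have -> : E^T *m E = F^T *m P A B *m P B C *m (P C A *m F).
    have mid : set_mx C *m (set_mx C)^T *m set_mx B =
               set_mx B *m (set_mx C)^T *m set_mx C.
      by rewrite set_mxCT -mulmxA (set_mxC C) mulmxA -set_mxCT.
    rewrite /E /P !trmx_mul !trmxK !mulmxA.
    by rewrite -!(mulmxA (F^T *m set_mx A *m (set_mx B)^T)) mid !mulmxA.
  (* Each use absorbs one factor 2 and the operator next to [F], while [r] accumulates the
     coefficients, starting from 1. *)
  have step X Y r m (M : 'M_#|G|) : 2%:R *: (P X Y *m F) = m *: F ->
      2%:R *: (r *: (M *m P X Y *m F)) = (r * m) *: (M *m F).
    move=> eqF; rewrite -[(r * m) *: _]scalerA [m *: _]scalemxAr -eqF.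
    by rewrite -mulmxA -scalemxAr !scalerA mulrC.
  rewrite mulmxA (_ : 8%:R = 2%:R * 2%:R * 2%:R * 1 :> int) // -!scalerA.
  rewrite (step _ _ _ _ _ mulCA) (step _ _ _ _ _ mulBC) (step _ _ _ _ _ mulAB).
  by congr (_ *: _); ring.
apply: mxtrace_mulmx_tr_le0.
have m_gt0 : 0 < (a + b - c) * (b + c - a) * (c + a - b) by rewrite !mulr_gt0.
(* The trace on the left is nonnegative and the coefficient on the right negative, so the trace of
   [F^T F] is at most 0. *)
have := congr1 mxtrace mulE; rewrite !mxtraceZ => trE.
rewrite -(pmulr_rle0 _ m_gt0) -oppr_ge0 -mulNr -trE.
by rewrite mulr_ge0 ?mxtrace_mulmx_tr_ge0.
Qed.

(** * From difference multisets to matrix identities *)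

Lemma count_ext_diffs m (D : m.-tuple {set G}) i (g : G) :
  count_mem g (ext_diffs D i) =
  (\sum_(j < m | j != i) count_mem g (Delta (tnth D i) (tnth D j)))%N.
Proof. by apply: big_morph => // s t; rewrite count_cat. Qed.

(** Diagonal entries count the difference 0, which does not occur, and off-diagonal entries count
    nonzero differences; this is the pattern of [K]. *)
Lemma GSEDF_set_mx v m (k lambda : m.-tuple nat) (D : m.-tuple {set G}) i :
    is_GSEDF v k lambda D ->
  \sum_(j < m | j != i) set_mx (tnth D i) *m (set_mx (tnth D j))^T =
  (tnth lambda i)%:R *: K.
Proof.
case=> _ [_ _ _ countD zeroD]; apply/matrixP=> r s.
rewrite summxE.
under eq_bigr => j _ do rewrite set_mx_mul_tr mxE.
rewrite -natr_sum -count_ext_diffs !mxE.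
have [->|r_neq_s] := eqVneq r s.
  by rewrite !subrr (count_memPn (zeroD i)) mulr0.
rewrite countD ?subr0 ?mulr1 //; apply: contra r_neq_s.
by rewrite subr_eq0 => /eqP/enum_val_inj->.
Qed.

Lemma set_mxU A B : [disjoint A & B] -> set_mx (A :|: B) = set_mx A + set_mx B.
Proof.
move=> disjAB; apply/matrixP=> r s; rewrite !mxE inE.
case: (boolP (_ \in A)) => [/(disjointFr disjAB)->|_]; first by rewrite addr0.
by rewrite add0r.
Qed.

End Sets.

Theorem theorem3p4 (v k1 k2 k3 lambda1 lambda2 lambda3 : nat)
    (hv : 0 < v) (hk1 : 0 < k1) (hk2 : 0 < k2) (hk3 : 0 < k3)
    (hl1 : 0 < lambda1) (hl2 : 0 < lambda2) (hl3 : 0 < lambda3)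
    (hk : k1 + k2 + k3 < v) :
  ~ exists (G : finZmodType) (D : 3.-tuple {set G}),
      is_GSEDF v [tuple k1; k2; k3] [tuple lambda1; lambda2; lambda3] D.
Proof.
move=> [G [D gsedf]]; have [[cardG _ _] [disj n0 cardD _ _]] := gsedf.
pose i0 : 'I_3 := ord0; pose i2 : 'I_3 := ord_max.
pose i1 : 'I_3 := @Ordinal 3 1 isT.
pose A := tnth D i0; pose B := tnth D i1; pose C := tnth D i2.
(* Three distinct indices exhaust ['I_3]; leaving their order free yields the sums in cyclic
   form. *)
have sumE i j l (F : 'I_3 -> 'M[int]_#|G|) : uniq [:: i; j; l] ->
    (\sum_(h < 3 | h != i) F h = F j + F l)%R.
  move=> ijl; have ijlT : perm_eq [:: i; j; l] (index_enum 'I_3).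
    apply: uniq_perm => //; first exact: index_enum_uniq.
    apply: (uniq_min_size ijl _ _).2 => [h _|]; first exact: mem_index_enum.
    by rewrite [index_enum _]unlock -enumT size_enum_ord.
  move: ijl; rewrite -(perm_big _ ijlT) /= !inE negb_or.
  case/andP=> /andP[ij il] _; rewrite !big_cons big_nil eqxx.
  by rewrite ![_ == i]eq_sym ij il addr0.
have disjAB : [disjoint A & B] by exact: disj.
have disjABC : [disjoint A :|: B & C].
  by rewrite -setI_eq0 setIUl setU_eq0 !setI_eq0 !disj.
have eqU : set_mx (A :|: B :|: C) = (set_mx A + set_mx B + set_mx C)%R.
  by rewrite !set_mxU.
have := GSEDF_set_mx i2 gsedf; have := GSEDF_set_mx i1 gsedf.
have := GSEDF_set_mx i0 gsedf.
rewrite (sumE i0 i1 i2) // (sumE i1 i2 i0) // (sumE i2 i0 i1) // => eqA eqB eqC.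
have := triple_union_trivial eqU (n0 i0) (n0 i1) (n0 i2) eqA eqB eqC.
have cardU : #|A :|: B :|: C| = k1 + k2 + k3.
  rewrite !cardsU !disjoint_setI0 // cards0 !subn0.
  by rewrite (cardD i0) (cardD i1) (cardD i2).
(* An empty union contradicts [0 < k1], a full one contradicts [hk]. *)
case/orP=> /eqP U_eq; move: cardU; rewrite U_eq ?cards0 ?cardsT ?cardG; lia.
Qed.
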